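(* Let $\mathfrak{X}$ be a fusion action system of a finite $p$-group $S$ on a finite set $X$. Then $\mathfrak{X}$ is saturated if and only if $S$ is fully automized and every fully normalized subgroup of $S$ is receiving.
   Context: Let $p$ be a prime, $S$ a finite $p$-group, and $X$ a finite set with a left $S$-action; $\Sigma_X$ is the symmetric group on $X$, $\ell_s\in\Sigma_X$ is the permutation $x\mapsto s\cdot x$, and $c_s$ is conjugation $h\mapsto shs^{-1}$. $\mathrm{Inj}(P,Q)$ is the set of injective homomorphisms $P\to Q$. A pair $(\varphi,\sigma)\in\mathrm{Inj}(P,Q)\times\Sigma_X$ ($P,Q\le S$) is intertwined if $\sigma\ell_p\sigma^{-1}=\ell_{\varphi(p)}$ for all $p\in P$. Let $\mathfrak{U}$ be the category whose objects are all subgroups of $S$, whose morphisms $P\to Q$ are the intertwined pairs, composed componentwise. Let $\mathfrak{X}_S\subseteq\mathfrak{U}$ have the same objects and morphisms $P\to Q$ the pairs $(c_s|_P,\ell_s)$ with $s\in S$, $sPs^{-1}\le Q$. A fusion action system of $S$ on $X$ is a category $\mathfrak{X}$ with $\mathfrak{X}_S\subseteq\mathfrak{X}\subseteq\mathfrak{U}$ such that every morphism of $\mathfrak{X}$ factors as an isomorphism of $\mathfrak{X}$ followed by an inclusion $(\mathrm{incl},\mathrm{id}_X)$. Write $\mathfrak{X}(P)=\mathfrak{X}(P,P)$ and $\mathfrak{X}(P,Q)_{\mathrm{iso}}$ for the isomorphisms. The underlying fusion system $\mathcal{F}^{\mathfrak{X}}$ has the subgroups of $S$ as objects and $\mathcal{F}^{\mathfrak{X}}(P,Q)=\{\varphi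 : \exists\sigma,\ (\varphi,\sigma)\in\mathfrak{X}(P,Q)\}$; two subgroups are conjugate if they are isomorphic in $\mathcal{F}^{\mathfrak{X}}$. Let $C=\{s\in S:\ell_s=\mathrm{id}_X\}$, $N_S(P;X)=N_S(P)\cap C$, $Z_S(P;X)=Z_S(P)\cap C$. A subgroup $P\le S$ is fully normalized (resp. fully centralized, fully $X$-normalized, fully $X$-centralized) if $|N_S(P)|\ge|N_S(Q)|$ (resp. the same inequality for $Z_S(-)$, $N_S(-;X)$, $Z_S(-;X)$) for all $Q$ conjugate to $P$. Put $\mathrm{Aut}_S(P)=\{c_s|_P:s\in N_S(P)\}$, $\mathrm{Aut}_S(P;X)=\{(c_s|_P,\ell_s):s\in N_S(P)\}$, $\Sigma_{\mathfrak{X}}(P)=\{\sigma:\exists\varphi,(\varphi,\sigma)\in\mathfrak{X}(P)\}$, $\Sigma^S_{\mathfrak{X}}(P)=\{\ell_s:s\in N_S(P)\}$, $\mathcal{F}^{\mathfrak{X}}(P)_0=\{\varphi:(\varphi,\mathrm{id}_X)\in\mathfrak{X}(P)\}$, $\mathcal{F}_S(P)_0=\{c_s|_P:s\in N_S(P;X)\}$, $\Sigma_{\mathfrak{X}}(P)_0=\{\sigma:(\mathrm{id}_P,\sigma)\in\mathfrak{X}(P)\}$, $\Sigma^S_{\mathfrak{X}}(P)_0=\{\ell_s:s\in Z_S(P)\}$. The extender of $(\varphi,\sigma)\in\mathfrak{X}(P,Q)_{\mathrm{iso}}$ is $N_{(\varphi,\sigma)}=\{n\in N_S(P):(\varphi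 c_n\varphi^{-1},\sigma\ell_n\sigma^{-1})\in\mathrm{Aut}_S(Q;X)\}$. $\mathfrak{X}$ is saturated if: (1) for every $P\le S$, fully normalized implies fully $X$-normalized and fully centralized, and each of fully $X$-normalized and fully centralized implies fully $X$-centralized; (2) if $P$ is fully normalized then $\mathrm{Aut}_S(P)\in\mathrm{Syl}_p(\mathcal{F}^{\mathfrak{X}}(P))$, $\mathrm{Aut}_S(P;X)\in\mathrm{Syl}_p(\mathfrak{X}(P))$ and $\Sigma^S_{\mathfrak{X}}(P)\in\mathrm{Syl}_p(\Sigma_{\mathfrak{X}}(P))$; (3) if $P$ is fully $X$-normalized then $\mathcal{F}_S(P)_0\in\mathrm{Syl}_p(\mathcal{F}^{\mathfrak{X}}(P)_0)$; (4) if $P$ is fully centralized then $\Sigma^S_{\mathfrak{X}}(P)_0\in\mathrm{Syl}_p(\Sigma_{\mathfrak{X}}(P)_0)$; (5) if $Q$ is fully $X$-centralized and $(\varphi,\sigma)\in\mathfrak{X}(P,Q)_{\mathrm{iso}}$, there is $(\widetilde\varphi,\sigma)\in\mathfrak{X}(N_{(\varphi,\sigma)},S)$ with $\widetilde\varphi|_P=\varphi$. $P\le S$ is fully automized if $\mathrm{Aut}_S(P;X)\in\mathrm{Syl}_p(\mathfrak{X}(P))$. $P$ is receiving if for all $Q\le S$ and $(\varphi,\sigma)\in\mathfrak{X}(Q,P)_{\mathrm{iso}}$ there is $(\widetilde\varphi,\sigma)\in\mathfrak{X}(N_{(\varphi,\sigma)},S)$ with $\widetilde\varphi|_Q=\varphi$.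 *)

(* Defs.v *)
From HB Require Import structures.
From mathcomp Require Import all_boot all_fingroup all_solvable.

Set Implicit Arguments.
Unset Strict Implicit.
Unset Printing Implicit Defensive.

Import GroupScope.

(* The finite p-group is the finGroupType S itself, so its subgroups are the  *)
(* P : {group S}, with N_S(P) = 'N(P) and Z_S(P) = 'C(P).                     *)

(* The actions of the action library are right actions.                       *)
Record left_action (S : finGroupType) (X : finType) := LeftAction {
  lact :> S -> X -> X;
  lact1 : forall x, lact 1 x = x;
  lactM : forall s t x, lact (s * t) x = lact s (lact t x) }.

Section Permutations.

Variables (S : finGroupType) (X : finType) (act : left_action S X).

Lemma lact_inj s : injective (act s).
Proof.
by apply: (can_inj (g := act s^-1)) => x; rewrite -lactM mulVg lact1.
Qed.

Definition ell s : {perm X} := perm (@lact_inj s).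

(* Products in {perm X} are read from left to right.                          *)
Lemma ellM s t : ell (s * t) = ell t * ell s.
Proof. by apply/permP => x; rewrite permM !permE lactM. Qed.

Lemma ell1 : ell 1 = 1.
Proof. by apply/permP => x; rewrite !permE lact1. Qed.

Definition act_ker : {set S} := [set s | ell s == 1].

End Permutations.

(* A homomorphism with domain P is encoded by its extension by 1 to all of S, *)
(* so that equality of morphisms is Leibniz equality and composition of       *)
(* morphisms is composition of functions; the codomain is not recorded.       *)
Notation hmap S := {ffun S -> S} (only parsing).
Notation mor S X := ({ffun S -> S} * {perm X})%type (only parsing).

Section Morphisms.

Variables (S : finGroupType) (X : finType) (act : left_action S X).
Implicit Types (P Q : {group S}) (s n : S) (m : mor S X).

Definition restr (P : {set S}) (f : S -> S) : hmap S :=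
  [ffun x => if x \in P then f x else 1].

Definition inj_homs P Q : {set hmap S} :=
  [set f : hmap S | [&& restr P f == f, morphic P f, dinjectiveb f (mem P)
                      & f @: P \subset Q]].

Definition hcomp (g f : hmap S) : hmap S := [ffun x => g (f x)].
Definition hid P : hmap S := restr P id.
Definition hinv P (f : hmap S) : hmap S :=
  [ffun y => odflt 1 [pick x in P | f x == y]].

(* mcomp m2 m1 is m2 after m1; the permutation order is that of ellM.         *)
Definition mcomp m2 m1 : mor S X := (hcomp m2.1 m1.1, m1.2 * m2.2).
Definition mid P : mor S X := (hid P, 1).
Definition minv P m : mor S X := (hinv P m.1, m.2^-1).

Definition cconj s : S -> S := fun h => s * h * s^-1.
Definition inner P s : mor S X := (restr P (cconj s), ell act s).

(* m.2^-1 * ell p * m.2 is the composite sigma o ell_p o sigma^-1.            *)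
Definition intertwined P m :=
  [forall p in P, m.2^-1 * ell act p * m.2 == ell act (m.1 p)].

Definition U_hom P Q : {set mor S X} :=
  [set m | (m.1 \in inj_homs P Q) && intertwined P m].

Definition XS_hom P Q : {set mor S X} :=
  [set inner P s | s in [set s : S | cconj s @: P \subset Q]].

Definition isos (H : {group S} -> {group S} -> {set mor S X}) P Q :=
  [set m in H P Q | [exists m' in H Q P,
    (mcomp m' m == mid P) && (mcomp m m' == mid Q)]].

(* mid R, seen as a morphism from R to an overgroup Q of R, is the inclusion; *)
(* identities and inclusions belong to XS_hom, being inner R 1 (inner1).      *)
Record fusion_action_system := FusionActionSystem {
  fas_hom :> {group S} -> {group S} -> {set mor S X};
  fas_sub : forall P Q, fas_hom P Q \subset U_hom P Q;
  fas_inner : forall P Q, XS_hom P Q \subset fas_hom P Q;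
  fas_comp : forall (P Q R : {group S}) (m m' : mor S X),
    m \in fas_hom P Q -> m' \in fas_hom Q R -> mcomp m' m \in fas_hom P R;
  fas_factor : forall P Q m, m \in fas_hom P Q ->
    exists2 R : {group S}, R \subset Q &
    exists2 m', m' \in isos fas_hom P R & m = mcomp (mid R) m' }.

End Morphisms.

Arguments isos {S X}.
Arguments mid {S X}.
Arguments minv {S X}.

Section Encoding.

(* Sets of automorphisms of P are transported to sets of permutations of S    *)
(* fixing S \ P, as for the library's Aut P, so as to use its Sylow theory.   *)
(* Products of permutations being read from left to right, this produces the  *)
(* opposite groups, which have the same subgroups.                            *)
Variables (S : finGroupType) (X : finType).
Implicit Types (P : {group S}).

Definition aut_perms P (A : {set hmap S}) : {set {perm S}} :=
  [set a in Aut P | restr P a \in A].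

Definition aut_pairs P (A : {set mor S X}) : {set {perm S} * {perm X}} :=
  [set a | (a.1 \in Aut P) && ((restr P a.1, a.2) \in A)].

End Encoding.

Section FusionActionSystems.

Variables (p : nat) (S : finGroupType) (X : finType) (act : left_action S X).
Variable (FX : fusion_action_system act).
Implicit Types (P Q : {group S}) (m : mor S X).

Definition fus P Q : {set hmap S} := [set m.1 | m in FX P Q].

Definition fconj P Q := exists f g : hmap S,
  [/\ f \in fus P Q, g \in fus Q P, hcomp g f = hid P & hcomp f g = hid Q].

Definition norm_ker P : {set S} := 'N(P) :&: act_ker act.
Definition cent_ker P : {set S} := 'C(P) :&: act_ker act.

Definition fully_normalized P := forall Q, fconj P Q -> #|'N(Q)| <= #|'N(P)|.
Definition fully_centralized P := forall Q, fconj P Q -> #|'C(Q)| <= #|'C(P)|.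
Definition fully_Xnormalized P :=
  forall Q, fconj P Q -> #|norm_ker Q| <= #|norm_ker P|.
Definition fully_Xcentralized P :=
  forall Q, fconj P Q -> #|cent_ker Q| <= #|cent_ker P|.

Definition AutS P : {set hmap S} := [set restr P (cconj s) | s in 'N(P)].
Definition AutSX P : {set mor S X} := [set inner act P s | s in 'N(P)].
Definition Sigma P : {set {perm X}} := [set m.2 | m in FX P P].
Definition SigmaS P : {set {perm X}} := [set ell act s | s in 'N(P)].
Definition fus0 P : {set hmap S} := [set f : hmap S | (f, 1) \in FX P P].
Definition fusS0 P : {set hmap S} := [set restr P (cconj s) | s in norm_ker P].
Definition Sigma0 P : {set {perm X}} := [set sg | (hid P, sg) \in FX P P].
Definition SigmaS0 P : {set {perm X}} := [set ell act s | s in 'C(P)].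

Definition extender_set P Q m : {set S} :=
  [set n in 'N(P) | mcomp m (mcomp (inner act P n) (minv P m)) \in AutSX Q].

(* extender_set is already a subgroup when m is an isomorphism: extenderE.    *)
Definition extender P Q m : {group S} := <<extender_set P Q m>>%G.

Definition extends P Q m := exists2 f : hmap S,
  (f, m.2) \in FX (extender P Q m) [set: S]%G & restr P f = m.1.

Definition fully_automized P :=
  p.-Sylow(aut_pairs P (FX P P)) (aut_pairs P (AutSX P)).

Definition receiving P := forall Q m, m \in isos FX Q P -> extends Q P m.

Record saturated : Prop := Saturated {
  sat_normalized : forall P, fully_normalized P ->
    fully_Xnormalized P /\ fully_centralized P;
  sat_Xnormalized : forall P, fully_Xnormalized P -> fully_Xcentralized P;
  sat_centralized : forall P, fully_centralized P -> fully_Xcentralized P;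
  sat_sylow : forall P, fully_normalized P ->
    [/\ p.-Sylow(aut_perms P (fus P P)) (aut_perms P (AutS P)),
        p.-Sylow(aut_pairs P (FX P P)) (aut_pairs P (AutSX P))
      & p.-Sylow(Sigma P) (SigmaS P)];
  sat_sylow_fus0 : forall P, fully_Xnormalized P ->
    p.-Sylow(aut_perms P (fus0 P)) (aut_perms P (fusS0 P));
  sat_sylow_Sigma0 : forall P, fully_centralized P ->
    p.-Sylow(Sigma0 P) (SigmaS0 P);
  sat_extension : forall P Q m, fully_Xcentralized Q ->
    m \in isos FX P Q -> extends P Q m }.

End FusionActionSystems.

Section Facts.

Variables (S : finGroupType) (X : finType) (act : left_action S X).
Implicit Types (P Q : {group S}) (m : mor S X).

Lemma isos_imset (H : {group S} -> {group S} -> {set mor S X}) P Q m :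
    (forall P Q, H P Q \subset U_hom act P Q) -> m \in isos H P Q ->
  [/\ {in P &, {morph m.1 : x y / x * y}}, {in P &, injective m.1}
    & m.1 @: P = Q].
Proof.
move=> sHU; rewrite inE => /andP[Hm /existsP[m' /and3P[Hm' _ /eqP[E2 _]]]].
have := subsetP (sHU _ _) _ Hm; rewrite !inE => /andP[/and4P[_ mM mI sPQ] _].
have := subsetP (sHU _ _) _ Hm'; rewrite !inE => /andP[/and4P[_ _ _ sQP] _].
split; first exact/morphicP; first exact/dinjectiveP.
apply/eqP; rewrite eqEsubset sPQ; apply/subsetP => y Qy.
apply/imsetP; exists (m'.1 y); first exact: (subsetP sQP _ (imset_f _ Qy)).
by move/ffunP/(_ y): E2; rewrite !ffunE Qy.
Qed.

Lemma hinvK P (f : hmap S) :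
  {in P &, injective f} -> {in P, cancel f (hinv P f)}.
Proof.
move=> fI x Px; rewrite ffunE; case: pickP => [z /andP[Pz /eqP/fI->] //|].
by move/(_ x); rewrite Px eqxx.
Qed.

Lemma cconj_norm P n x : n \in 'N(P) -> (cconj n x \in P) = (x \in P).
Proof.
move=> nP; rewrite /cconj -[in RHS](memJ_norm _ (groupVr nP)).
by rewrite conjgE invgK mulgA.
Qed.

Lemma cconjM s t x : cconj (s * t) x = cconj s (cconj t x) :> S.
Proof. by rewrite /cconj invMg !mulgA. Qed.

Lemma extender_setP P Q m n :
    {in P &, injective m.1} -> m.1 @: P = Q -> m.1 1 = 1 ->
  reflect (n \in 'N(P) /\ exists2 s, s \in 'N(Q) &
             {in P, forall x, m.1 (cconj n x) = cconj s (m.1 x)}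
             /\ m.2^-1 * ell act n * m.2 = ell act s)
          (n \in extender_set act P Q m).
Proof.
move=> mI defQ m1; have PQ x : x \in P -> m.1 x \in Q.
  by move=> Px; rewrite -defQ imset_f.
rewrite [_ \in extender_set _ _ _ _]inE.
apply: (iffP andP) => [[nP /imsetP[s sQ [/ffunP E1 E2]]]|].
  split=> //; exists s => //; split=> [x Px|]; last by rewrite -E2.
  have := E1 (m.1 x); rewrite ffunE [hcomp _ _ _]ffunE /= hinvK //.
  by rewrite !ffunE Px PQ.
case=> nP [s sQ [E1 E2]]; split=> //; apply/imsetP; exists s => //.
congr (_, _) => //=; apply/ffunP => y; rewrite ffunE [hcomp _ _ _]ffunE.
have [Qy | nQy] := boolP (y \in Q).
  have /imsetP[x Px defy] : y \in m.1 @: P by rewrite defQ.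
  by rewrite [restr Q _ _]ffunE Qy defy hinvK // ffunE Px E1.
rewrite [hinv _ _ _]ffunE; case: pickP => [x /andP[Px /eqP xy]|_] /=.
  by rewrite -xy PQ in nQy.
by rewrite !ffunE (negPf nQy) group1 /cconj mulg1 mulgV.
Qed.

Lemma extenderE (FX : fusion_action_system act) P Q m :
  m \in isos FX P Q -> extender act P Q m = extender_set act P Q m :> {set S}.
Proof.
move=> /(isos_imset (@fas_sub _ _ _ FX))[mM mI defQ].
have m1 : m.1 1 = 1.
  by apply: (mulgI (m.1 1)); rewrite -mM ?group1 // !mulg1.
suffices gE : group_set (extender_set act P Q m) by apply: (gen_set_id gE).
apply/group_setP; split=> [|n n'].
  apply/extender_setP; rewrite ?group1 //; split=> //; exists 1 => //.
  by split=> [x Px|]; rewrite /cconj ?ell1 ?invg1 ?mul1g ?mulg1 // mulVg.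
case/extender_setP=> // nP [s sQ [E1 E2]].
case/extender_setP=> // n'P [s' s'Q [E1' E2']].
apply/extender_setP=> //; split; first exact: groupM.
exists (s * s'); first exact: groupM.
split=> [x Px|]; last by rewrite !ellM -E2 -E2' !mulgA mulgK.
by rewrite !cconjM E1 ?cconj_norm // E1'.
Qed.

Lemma Aut_perm1 P a : a \in Aut P -> a 1 = 1.
Proof. by move=> aP; rewrite -(autmE aP) morph1. Qed.

Lemma restr_Aut_inj P : {in Aut P &, injective (fun a : {perm S} => restr P a)}.
Proof.
move=> a b aP bP /ffunP E; apply: (eq_Aut aP bP) => x Px.
by have := E x; rewrite !ffunE Px.
Qed.

Lemma restr_AutM P a b : a \in Aut P -> b \in Aut P ->
  restr P (a * b)%g = hcomp (restr P b) (restr P a).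
Proof.
move=> aP bP; apply/ffunP=> x; rewrite !ffunE permM.
have [Px | _] := boolP (x \in P); first by rewrite Aut_closed.
by rewrite group1 (Aut_perm1 bP).
Qed.

Lemma restr_Aut1 P : restr P (1 : {perm S})%g = hid P.
Proof. by apply/ffunP=> x; rewrite !ffunE perm1. Qed.

Lemma inj_homs_Aut P f :
  reflect (exists2 a, a \in Aut P & restr P a = f) (f \in inj_homs P P).
Proof.
rewrite inE; apply: (iffP and4P) => [[/eqP fr fM /dinjectiveP fI fP]|].
  exists (perm_in fI fP).
    rewrite inE perm_in_on; apply/morphicP=> x y Px Py.
    by rewrite !perm_inE ?groupM // (morphicP fM).
  apply/ffunP=> x; rewrite ffunE -[in RHS]fr ffunE; case: ifP => // Px.
  by rewrite perm_inE.
case=> a aP <-; split.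
- by apply/eqP/ffunP=> x; rewrite !ffunE; case: (x \in P).
- apply/morphicP=> x y Px Py; rewrite !ffunE Px Py groupM //.
  exact: (morphicP (Aut_morphic aP)).
- by apply/dinjectiveP=> x y Px Py; rewrite !ffunE Px Py; apply: perm_inj.
by apply/subsetP=> _ /imsetP[x Px ->]; rewrite ffunE Px Aut_closed.
Qed.

Lemma aut_perms_group P (A : {set hmap S}) :
    hid P \in A -> {in A &, forall f g, hcomp g f \in A} ->
  group_set (aut_perms P A).
Proof.
move=> A1 AM; apply/group_setP; split=> [|a b].
  by rewrite inE group1 restr_Aut1.
rewrite inE => /andP[aP aA]; rewrite inE => /andP[bP bA].
by rewrite inE groupM // restr_AutM //; apply: AM aA bA.
Qed.

Lemma aut_pairs_group P (A : {set mor S X}) :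
    mid P \in A -> {in A &, forall m m', mcomp m' m \in A} ->
  group_set (aut_pairs P A).
Proof.
move=> A1 AM; apply/group_setP; split=> [|a b].
  by rewrite inE group1 restr_Aut1.
rewrite inE => /andP[aP aA]; rewrite inE => /andP[bP bA].
by rewrite inE groupM // restr_AutM //; apply: AM aA bA.
Qed.

Lemma inner1 P : inner act P 1 = mid P.
Proof.
congr (_, _); last exact: ell1.
by apply/ffunP=> x; rewrite !ffunE /cconj invg1 mul1g mulg1.
Qed.

Lemma innerM P s t : t \in 'N(P) ->
  mcomp (inner act P s) (inner act P t) = inner act P (s * t).
Proof.
move=> tP; congr (_, _); last by rewrite /= ellM.
apply/ffunP=> x; rewrite !ffunE; case: (boolP (x \in P)) => Px.
  by rewrite cconj_norm // Px cconjM.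
by rewrite group1 /cconj mulg1 mulgV.
Qed.

Lemma fas_mid (FX : fusion_action_system act) P Q :
  P \subset Q -> mid P \in FX P Q.
Proof.
move=> sPQ; apply: (subsetP (fas_inner FX P Q)); apply/imsetP; exists 1.
  rewrite inE; apply/subsetP=> _ /imsetP[x Px ->].
  by rewrite /cconj invg1 mul1g mulg1 (subsetP sPQ).
by rewrite inner1.
Qed.

Lemma aut_pairs_fas_group (FX : fusion_action_system act) P :
  group_set (aut_pairs P (FX P P)).
Proof.
apply: aut_pairs_group => [|m m']; first exact: fas_mid.
exact: fas_comp.
Qed.

Lemma aut_pairs_AutSX_group P : group_set (aut_pairs P (AutSX act P)).
Proof.
apply: aut_pairs_group => [|_ _ /imsetP[s sP ->] /imsetP[t tP ->]].
  by rewrite -inner1 imset_f ?group1.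
by rewrite innerM // imset_f ?groupM.
Qed.

End Facts.

(* Main.v *)
Require Import Defs.
From mathcomp Require Import all_boot all_fingroup all_solvable.

Set Implicit Arguments.
Unset Strict Implicit.
Unset Printing Implicit Defensive.

Import GroupScope.

(** Isomorphisms (phi, sigma) of the fusion action system are realized by pairs
    of permutations (of S, and of X), so that the automorphism groups of
    conjugate subgroups are conjugate subgroups of one finite group (autXJ) and
    Sylow theory is available.

    If the system is saturated, then S, being fully normalized, is fully
    automized, and a fully normalized subgroup is fully X-centralized, hence
    receiving by the extension axiom.

    Conversely, the key step is that every fully normalized P is fully
    automized (fully_normalized_automized).  This goes by induction on the
    index of P: an automorphism of p-power order that normalizes the
    automorphisms induced by S extends to the normalizer of P, where the
    induction hypothesis shows that it is induced by an element of S.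

    It follows by Sylow and the receiving property that each conjugate Q of P
    has an isomorphism to P that extends to a morphism from the normalizer of Q
    to that of P (receiving_dominates).  Since morphisms intertwine the action
    on X, the extension maps the centralizer of Q and the intersections of the
    normalizer and the centralizer with the kernel of the action into those of
    P, and onto them if their orders are maximal for Q (fully_onto).  This
    yields the implications between the maximality conditions (fully_sub) and
    transports to Q the Sylow conditions (fully_Sylow), which hold for P because
    the groups involved are images and normal subgroups of the automorphism
    group of P.  The extension axiom for a fully X-centralized Q results from
    extending the composite isomorphism to P and undoing the extension to the
    normalizer of Q (fully_Xcentralized_extends). *)

(** * Permutations, conjugations and elements of prime power order *)

Lemma perm_extending (T : finType) (A : {set T}) (f : T -> T) :
  {in A &, injective f} -> exists e : {perm T}, {in A, e =1 f}.
Proof.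
move=> fI; pose B := f @: A.
have cAB : #|~: A| = #|~: B|.
  by apply: (@addnI #|A|); rewrite cardsC -(card_in_imset fI) cardsC.
(* Match the complements of A and of its image by their enumerations. *)
pose e x :=
  if x \in A then f x else nth x (enum (~: B)) (index x (enum (~: A))).
have eB x : x \notin A -> e x \in ~: B.
  move=> nAx; rewrite /e (negPf nAx) -mem_enum mem_nth // -cardE -cAB cardE.
  by rewrite index_mem mem_enum inE.
have eI : injective e.
  move=> x y; have [Ax | nAx] := boolP (x \in A);
    have [Ay | nAy] := boolP (y \in A).
  - by rewrite /e Ax Ay => /fI->.
  - by move=> exy; have := eB y nAy; rewrite -exy /e Ax inE imset_f.
  - by move=> exy; have := eB x nAx; rewrite exy /e Ay inE imset_f.
  have ix z : z \notin A -> index z (enum (~: A)) < size (enum (~: B)).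
    by move=> nAz; rewrite -cardE -cAB cardE index_mem mem_enum inE.
  rewrite /e (negPf nAx) (negPf nAy) (set_nth_default y) ?ix // => /eqP.
  rewrite nth_uniq ?ix ?enum_uniq // => /eqP exy.
  by apply: (index_inj x) exy; rewrite mem_enum inE.
by exists (perm eI) => x Ax; rewrite permE /e Ax.
Qed.

(** A power of the pair (x, y), namely its p-part, fixes the p-element x and
    turns y into a p-element; hence one exponent serves for both. *)
Lemma p_elt_power (p : nat) (gT1 gT2 : finGroupType) (x : gT1) (y : gT2) :
  p.-elt x -> exists k, x ^+ k = x /\ p.-elt (y ^+ k).
Proof.
move=> px; pose z : gT1 * gT2 := (x, y).
have /cycleP[k zk] := groupX (chinese #[z]`_p #[z]`_p^' 1 0) (cycle_id z).
exists k.
have fX : (z ^+ k).1 = x ^+ k := morphX (@fst_morphism _ _) k (in_setT z).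
have sX : (z ^+ k).2 = y ^+ k := morphX (@snd_morphism _ _) k (in_setT z).
have zp : z.`_p = z ^+ k := zk.
rewrite -fX -sX -zp; split.
  rewrite -[RHS](constt_p_elt px).
  exact: (@morph_constt _ _ _ (@fst_morphism gT1 gT2) p z (in_setT z)).
have -> : (z.`_p).2 = y.`_p.
  exact: (@morph_constt _ _ _ (@snd_morphism gT1 gT2) p z (in_setT z)).
exact: p_elt_constt.
Qed.

Section Conjugation.

Variable S : finGroupType.
Implicit Types (P : {group S}) (n s t : S).

Lemma restr_imset P (f : S -> S) : restr P f @: P = f @: P.
Proof. by apply: eq_in_imset => x Px; rewrite ffunE Px. Qed.

Lemma norm_cconj P t : {in P, forall x, cconj t x \in P} -> t \in 'N(P).
Proof.
move=> tP; rewrite -groupV inE; apply/subsetP=> _ /imsetP[x Px ->].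
by rewrite conjgE invgK mulgA; apply: tP.
Qed.

Lemma cent_cconj P n : reflect {in P, forall x, cconj n x = x} (n \in 'C(P)).
Proof.
apply: (iffP centP) => nC x Px; first by rewrite /cconj nC ?mulgK.
by rewrite /commute -{2}(nC x Px) /cconj mulgKV.
Qed.

Lemma mulV_cent P s t : t \in 'N(P) ->
  {in P, cconj s =1 cconj t} -> s * t^-1 \in 'C(P).
Proof.
move=> tP E; apply/cent_cconj=> x Px.
rewrite cconjM E ?cconj_norm ?groupV // -cconjM mulgV.
by rewrite /cconj invg1 mul1g mulg1.
Qed.

End Conjugation.

(** * The groupoid of isomorphisms, realized by permutations *)

Section FusionActionSystem.

Variables (p : nat) (S : finGroupType) (X : finType) (act : left_action S X).
Variable FX : fusion_action_system act.
Implicit Types (P Q R T N : {group S}) (m : mor S X).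
Local Notation perms := ({perm S} * {perm X})%type.
Implicit Types g h a y : perms.

Lemma FX_mor P Q m : m \in FX P Q ->
  [/\ restr P m.1 = m.1, {in P &, {morph m.1 : x y / x * y}},
      {in P &, injective m.1}, m.1 @: P \subset Q
    & {in P, forall x, ell act x ^ m.2 = ell act (m.1 x)}].
Proof.
move/(subsetP (fas_sub FX P Q)); rewrite !inE.
case/andP=> /and4P[/eqP mr mM mI sPQ] /forall_inP mX; split=> // [||x Px].
- exact/morphicP.
- exact/dinjectiveP.
by rewrite conjgE mulgA; apply/eqP/mX.
Qed.

Lemma FX_one P Q m : m \in FX P Q -> m.1 1 = 1.
Proof.
case/FX_mor=> _ mM _ _ _.
by apply: (mulgI (m.1 1)); rewrite -mM ?group1 // !mulg1.
Qed.

Lemma mcomp_mid P Q m : m \in FX P Q -> mcomp (mid Q) m = m.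
Proof.
move=> mF; have [mr _ _ sPQ _] := FX_mor mF.
rewrite [RHS]surjective_pairing /mcomp /= mulg1; congr (_, _).
apply/ffunP=> x; rewrite !ffunE; suffices -> : m.1 x \in Q by [].
rewrite -mr ffunE; case: ifP => Px; last exact: group1.
exact: (subsetP sPQ _ (imset_f _ Px)).
Qed.

Lemma FX_codom P Q R m : m \in FX P Q -> Q \subset R -> m \in FX P R.
Proof.
move=> mF sQR; rewrite -(mcomp_mid mF).
exact: fas_comp mF (fas_mid FX sQR).
Qed.

Lemma FX_image P Q m : m \in FX P Q ->
  exists R, [/\ R \subset Q, m.1 @: P = R & m \in isos FX P R].
Proof.
case/fas_factor=> R sRQ [m' m'i ->]; exists R.
have [_ _ m'P] := isos_imset (@fas_sub _ _ _ FX) m'i.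
have m'F : m' \in FX P R by move: m'i; rewrite inE => /andP[].
by rewrite (mcomp_mid m'F).
Qed.

Lemma isosE P Q m : (m \in isos FX P Q) = (m \in FX P Q) && (m.1 @: P == Q).
Proof.
apply/idP/andP=> [mi | [/FX_image[R [_ -> mi]] /eqP/group_inj <-] //].
have [_ _ ->] := isos_imset (@fas_sub _ _ _ FX) mi.
by move: mi; rewrite inE => /andP[].
Qed.

(** Morphisms are functions on S that are trivial outside their source, so
    that an isomorphism has no inverse among them as a function.  Replacing
    the function by a permutation of S that agrees with it on P puts all the
    isomorphisms into one finite group, in which composition is the product
    and transport along an isomorphism is conjugation. *)
Definition piso P Q : {set perms} :=
  [set g : perms | (restr P g.1, g.2) \in isos FX P Q].

Lemma pisoE P Q g :
  (g \in piso P Q) = ((restr P g.1, g.2) \in FX P Q) && (g.1 @: P == Q).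
Proof. by rewrite inE isosE restr_imset. Qed.

Lemma pisoP P Q g : g \in piso P Q ->
  [/\ {in P &, {morph g.1 : x y / x * y}}, g.1 @: P = Q
    & {in P, forall x, ell act x ^ g.2 = ell act (g.1 x)}].
Proof.
rewrite pisoE => /andP[/FX_mor[_ gM _ _ gX] /eqP gP]; split=> //
  [x y Px Py|x Px].
  by have /= := gM x y Px Py; rewrite !ffunE Px Py groupM.
by have /= := gX x Px; rewrite ffunE Px.
Qed.

Lemma piso_lift P Q m : m \in isos FX P Q ->
  exists2 g, g \in piso P Q & (restr P g.1, g.2) = m.
Proof.
move=> mi; have := mi; rewrite isosE => /andP[/FX_mor[mr _ mI _ _] _].
have [e em] := perm_extending mI.
suffices E : (restr P e, m.2) = m.
  by exists (e, m.2); rewrite // [_ \in piso _ _]inE /= E.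
rewrite [RHS]surjective_pairing; congr (_, _); rewrite -mr.
by apply/ffunP=> x; rewrite !ffunE; case: ifP => // /em.
Qed.

Lemma piso_eq P Q g h : g \in piso P Q -> {in P, h.1 =1 g.1} -> h.2 = g.2 ->
  h \in piso P Q.
Proof.
rewrite [_ \in _]inE => gi hg1 hg2; rewrite inE hg2.
suffices -> : restr P h.1 = restr P g.1 by [].
by apply/ffunP=> x; rewrite !ffunE; case: ifP => // /hg1.
Qed.

Lemma piso1 P : 1 \in piso P P.
Proof.
rewrite pisoE /= (_ : (restr P _, 1) = mid P); last first.
  by congr (_, _); apply: restr_Aut1.
rewrite fas_mid //=; apply/eqP/setP=> x; apply/imsetP/idP=> [[z Pz ->]|Px].
  by rewrite perm1.
by exists x; rewrite ?perm1.
Qed.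

Lemma pisoM P Q R g h : g \in piso P Q -> h \in piso Q R -> g * h \in piso P R.
Proof.
rewrite !pisoE => /andP[gF /eqP gP] /andP[hF /eqP hQ]; apply/andP; split.
  suffices -> : (restr P (g * h).1, (g * h).2)
      = mcomp (restr Q h.1, h.2) (restr P g.1, g.2) by exact: fas_comp gF hF.
  congr (_, _); apply/ffunP=> x; rewrite !ffunE permM; case: ifP => Px.
    by rewrite -gP imset_f.
  by have := FX_one hF; rewrite ffunE group1.
by rewrite -hQ -gP -imset_comp; apply/eqP/eq_imset=> x; rewrite permM.
Qed.

Lemma pisoV P Q g : g \in piso P Q -> g^-1 \in piso Q P.
Proof.
move=> gi; have [_ gP _] := pisoP gi; move: gi.
rewrite !inE => /andP[gF].
case/existsP=> m' /and3P[m'F /eqP[m'g1 m'g2] /eqP[gm'1 gm'2]].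
have [m'r _ _ _ _] := FX_mor m'F.
suffices -> : (restr Q g^-1.1, g^-1.2) = m'.
  rewrite m'F; apply/existsP; exists (restr P g.1, g.2).
  by rewrite gF /mcomp gm'1 m'g1 /= gm'2 m'g2 !eqxx.
rewrite [RHS]surjective_pairing; congr (_, _) => /=; last first.
  by apply: (mulIg g.2); rewrite mulVg gm'2.
rewrite -m'r; apply/ffunP=> x; rewrite !ffunE; case: ifP => // Qx.
move: Qx; rewrite -gP => /imsetP[z Pz ->]; rewrite permK.
by move/ffunP/(_ z): m'g1; rewrite !ffunE Pz.
Qed.

(** A restriction is at first only a morphism into Q; the factorization axiom
    makes it an isomorphism onto its image, which is again a subgroup. *)
Lemma pisoS P Q R g : g \in piso P Q -> R \subset P ->
  exists2 T : {group S}, T \subset Q & g \in piso R T.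
Proof.
rewrite pisoE => /andP[gF _] sRP.
have /FX_image[T [sTQ _ Ti]] := fas_comp (fas_mid FX sRP) gF; exists T => //.
rewrite inE; move: Ti; rewrite (_ : mcomp _ _ = (restr R g.1, g.2)) //.
congr (_, _); last by rewrite /= mul1g.
apply/ffunP=> x; rewrite !ffunE; have [Rx | _] := boolP (x \in R).
  by rewrite (subsetP sRP).
by rewrite group1; have := FX_one gF; rewrite ffunE group1.
Qed.

Lemma piso_mem P Q g x : g \in piso P Q -> (g.1 x \in Q) = (x \in P).
Proof. by case/pisoP=> _ <- _; rewrite mem_imset //; apply: perm_inj. Qed.

Lemma piso_card P Q g : g \in piso P Q -> #|P| = #|Q|.
Proof. by case/pisoP=> _ <- _; rewrite card_imset //; apply: perm_inj. Qed.

Lemma pisoJ P Q g n x : g \in piso P Q -> n \in P -> x \in P ->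
  g.1 (cconj n x) = cconj (g.1 n) (g.1 x).
Proof.
case/pisoP=> gM _ _ Pn Px; rewrite /cconj !gM ?groupM ?groupV //.
congr (_ * _); apply: (mulgI (g.1 n)); rewrite -gM ?groupV // !mulgV.
by apply: (mulgI (g.1 1)); rewrite -gM ?group1 // !mulg1.
Qed.

Lemma fconjP P Q : fconj FX P Q <-> exists g, g \in piso P Q.
Proof.
split=> [[f [f' [/imsetP[m mF ->]]]] | [g gi]].
  move/imsetP=> [m' m'F ->] m'm mm'.
  suffices /piso_lift[g gi _] : m \in isos FX P Q by exists g.
  have [_ _ _ sPQ _] := FX_mor mF; have [_ _ _ sQP _] := FX_mor m'F.
  rewrite isosE mF eqEsubset sPQ; apply/subsetP=> z Qz.
  apply/imsetP; exists (m'.1 z); first by rewrite (subsetP sQP) ?imset_f.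
  by move/ffunP/(_ z): mm'; rewrite !ffunE Qz.
exists (restr P g.1), (restr Q g^-1.1).
have gE z : (g.1 z \in Q) = (z \in P) by rewrite (piso_mem z gi).
have := gi; rewrite pisoE => /andP[gF _].
have := pisoV gi; rewrite pisoE => /andP[gVF _].
have [_ gP _] := pisoP gi.
have f1 : g.1 1 = 1 by have := FX_one gF; rewrite ffunE group1.
have f'1 : g.1^-1 1 = 1 by have := FX_one gVF; rewrite ffunE group1.
split; first by apply/imsetP; exists (restr P g.1, g.2).
- by apply/imsetP; exists (restr Q g^-1.1, g^-1.2).
- apply/ffunP=> x; rewrite !ffunE; case: (boolP (x \in P)) => Px.
    by rewrite gE Px permK.
  by rewrite group1 f'1.
apply/ffunP=> x; rewrite !ffunE; case: (boolP (x \in Q)) => Qx.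
  by rewrite -gE permKV Qx.
by rewrite group1 f1.
Qed.

Lemma fconj_sym P Q : fconj FX P Q -> fconj FX Q P.
Proof. by case/fconjP=> g gi; apply/fconjP; exists g^-1; apply: pisoV. Qed.

Lemma fconj_trans P Q R : fconj FX P Q -> fconj FX Q R -> fconj FX P R.
Proof.
case/fconjP=> g gi /fconjP[h hi].
by apply/fconjP; exists (g * h); apply: pisoM hi.
Qed.

Lemma fconj_piso P Q g : g \in piso P Q -> fconj FX P Q.
Proof. by move=> gi; apply/fconjP; exists g. Qed.

(** * Automorphism groups as groups of permutations *)

(** The extension y turns conjugation by n into conjugation by y.1 n, so that
    it carries elements normalizing Q to elements normalizing P. *)
Lemma piso_norm P Q N T y : y \in piso N T -> y \in piso Q P ->
  Q \subset N -> N \subset 'N(Q) -> T \subset 'N(P).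
Proof.
move=> yN yQ sQN nQN; have [_ defT _] := pisoP yN; have [_ defP _] := pisoP yQ.
apply/subsetP=> t; rewrite -defT => /imsetP[n Nn ->]; apply: norm_cconj => x.
rewrite -{1}defP => /imsetP[z Qz ->]; rewrite -(pisoJ yN Nn) ?(subsetP sQN) //.
by rewrite (piso_mem _ yQ) cconj_norm ?(subsetP nQN).
Qed.

Definition autX P : {group perms} := Group (aut_pairs_fas_group FX P).
Definition autSX P : {group perms} := Group (aut_pairs_AutSX_group act P).

Lemma mem_autX P a : (a \in autX P) = (a.1 \in Aut P) && (a \in piso P P).
Proof.
rewrite [LHS]inE pisoE; case: (boolP (a.1 \in Aut P)) => //= aP.
rewrite (_ : a.1 @: P == P) ?andbT // eqEcard card_imset; last exact: perm_inj.
by rewrite leqnn andbT; apply/subsetP=> _ /imsetP[x Px ->]; apply: Aut_closed.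
Qed.

Lemma mem_autSX P a : reflect
  (a.1 \in Aut P /\ exists2 s, s \in 'N(P) &
     {in P, a.1 =1 cconj s} /\ a.2 = ell act s)
  (a \in autSX P).
Proof.
rewrite [a \in _]inE; apply: (iffP andP) => -[aP].
  case/imsetP=> s sP [/ffunP E1 E2]; split=> //.
  exists s => //; split=> // x Px.
  by have := E1 x; rewrite !ffunE Px.
case=> s sP [E1 E2]; split=> //; apply/imsetP; exists s => //.
congr (_, _) => //; apply/ffunP=> x; rewrite !ffunE; case: ifP => // Px.
exact: E1.
Qed.

(** The perms-valued form of inner act P s.  The inverse comes from the
    convention of conj_aut, which conjugates from the right. *)
Definition conj_pair P s : perms := (conj_aut P s^-1, ell act s).

Lemma conj_pairE P s : s \in 'N(P) -> {in P, (conj_pair P s).1 =1 cconj s}.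
Proof.
move=> sP x Px; rewrite /= norm_conj_autE ?groupV //.
by rewrite conjgE invgK mulgA.
Qed.

Lemma conj_pair_eq P s a : s \in 'N(P) -> a.1 \in Aut P ->
  {in P, a.1 =1 cconj s} -> a.2 = ell act s -> a = conj_pair P s.
Proof.
move=> sP aP E1 E2; rewrite [LHS]surjective_pairing E2; congr (_, _).
by apply: (eq_Aut aP (Aut_aut _ _)) => x Px; rewrite E1 -?(conj_pairE sP).
Qed.

Lemma autSXE P : autSX P = conj_pair P @: 'N(P) :> {set perms}.
Proof.
apply/setP=> a; apply/mem_autSX/imsetP=> [[aP [s sP [E1 E2]]] | [s sP ->]].
  by exists s => //; apply: conj_pair_eq.
split; first exact: Aut_aut.
by exists s => //; split=> //; apply: conj_pairE.
Qed.

Lemma sub_AutSX P : AutSX act P \subset FX P P.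
Proof.
apply: subset_trans (fas_inner FX P P); apply/subsetP=> _ /imsetP[s sP ->].
apply: imset_f; rewrite inE; apply/subsetP=> _ /imsetP[x Px ->].
by rewrite cconj_norm.
Qed.

Lemma sub_autSX_autX P : autSX P \subset autX P.
Proof.
apply/subsetP=> a; rewrite [_ \in autSX P]inE => /andP[aP aA].
by rewrite [_ \in autX P]inE aP (subsetP (sub_AutSX P)).
Qed.

(** The assignment of conj_pair P s to s reverses products; composed with the
    inversion of S it becomes a morphism, so its image is a p-group. *)
Lemma pgroup_autSX P : p.-group [set: S] -> p.-group (autSX P).
Proof.
move=> pS; pose f s := conj_pair P s^-1.
have fM : {in 'N(P) &, {morph f : s t / s * t}}.
  move=> s t sP tP; congr (_, _); last by rewrite /= invMg ellM.
  by rewrite /= !invgK; apply: (conj_aut_morphM sP tP).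
apply: (pgroupS (G := Morphism fM @* 'N(P))); last first.
  exact/morphim_pgroup/(pgroupS (subsetT _) pS).
rewrite autSXE; apply/subsetP=> _ /imsetP[s sP ->].
by apply/morphimP; exists s^-1; rewrite ?groupV //= /f invgK.
Qed.

Lemma piso_autX P g : g \in piso P P ->
  exists2 a, a \in autX P & {in P, a.1 =1 g.1} /\ a.2 = g.2.
Proof.
move=> gi; have := gi; rewrite pisoE => /andP[gF _].
have := subsetP (fas_sub FX P P) _ gF; rewrite [_ \in _]inE => /andP[/= + _].
case/inj_homs_Aut=> b bP /ffunP bg.
have bE : {in P, b =1 g.1} by move=> x Px; have := bg x; rewrite !ffunE Px.
by exists (b, g.2) => //; rewrite mem_autX bP (piso_eq gi).
Qed.

(** Thanks to the realization by permutations, isomorphic subgroups have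
    automorphism groups that are conjugate, not just isomorphic; this is what
    lets the Sylow theorems be applied directly. *)
Lemma autXJ P Q g : g \in piso Q P -> autX Q :^ g = autX P.
Proof.
suffices sub P' Q' h : h \in piso Q' P' -> autX Q' :^ h \subset autX P'.
  move=> gi; apply/eqP; rewrite eqEsubset sub //=.
  by rewrite -sub_conjgV (sub _ _ _ (pisoV gi)).
move=> hi; apply/subsetP=> _ /imsetP[a aQ ->].
move: aQ; rewrite !mem_autX => /andP[aQ ai].
have ahi : a ^ h \in piso P' P' := pisoM (pisoV hi) (pisoM ai hi).
have [ahM _ _] := pisoP ahi; rewrite ahi andbT inE; apply/andP; split.
  apply/subsetP=> x; rewrite inE; apply: contraR.
  have [w ->] : exists w, x = h.1 w by exists (h.1^-1 x); rewrite permKV.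
  by rewrite (piso_mem _ hi) => nQw; rewrite permJ (out_Aut aQ nQw).
exact/morphicP.
Qed.

Lemma fully_normalized_conj P : exists2 R : {group S},
  fconj FX P R & fully_normalized FX R.
Proof.
have PP : [exists g, g \in piso P P] by apply/existsP; exists 1; apply: piso1.
case: (arg_maxnP (P := fun R : {group S} => [exists g, g \in piso P R])
         (fun R : {group S} => #|'N(R)|) PP) => R /existsP[g gi] Rmax.
exists R; first exact: fconj_piso gi.
move=> Q /(fconj_trans (fconj_piso gi))/fconjP[h hi].
by apply: Rmax; apply/existsP; exists h.
Qed.

(** * Extending isomorphisms to normalizers *)

(** The form in which the receiving property is used: N lies between Q and the
    extender of g, and the latter is described by what its elements do rather
    than through the set of pairs that encodes it. *)
Lemma receiving_extend P Q N g :
    receiving FX P -> g \in piso Q P -> Q \subset N -> N \subset 'N(Q) ->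
    {in N, forall n, exists2 s, s \in 'N(P) &
       {in Q, forall x, g.1 (cconj n x) = cconj s (g.1 x)}
       /\ ell act n ^ g.2 = ell act s} ->
  exists y, exists T, [/\ y \in piso N T, T \subset 'N(P), y \in piso Q P,
    {in Q, y.1 =1 g.1} & y.2 = g.2].
Proof.
move=> rP gi sQN nQN gN; pose m : mor S X := (restr Q g.1, g.2).
have mi : m \in isos FX Q P by move: gi; rewrite inE.
have [f fF fm] := rP Q m mi.
have sNE : N \subset extender act Q P m.
  rewrite (extenderE mi); apply/subsetP=> n Nn.
  have [_ mI mP] := isos_imset (@fas_sub _ _ _ FX) mi.
  have mF : m \in FX Q P by move: mi; rewrite isosE => /andP[].
  apply/extender_setP=> //; first exact: (FX_one mF).
  split; first exact: (subsetP nQN).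
  have [s sP [E1 E2]] := gN n Nn; exists s => //; split.
    by move=> x Qx; rewrite !ffunE cconj_norm ?(subsetP nQN) // Qx E1.
  by rewrite -E2 conjgE mulgA.
have [E' [_ _ /piso_lift[y yE [yf y2]]]] := FX_image fF.
have [T _ yN] := pisoS yE sNE.
have yg : {in Q, y.1 =1 g.1}.
  move=> x Qx; have /ffunP/(_ x) := fm; rewrite !ffunE Qx => <-.
  have /ffunP/(_ x) := yf; rewrite ffunE (subsetP sNE) // (subsetP sQN) //.
have yQ : y \in piso Q P by apply: piso_eq gi yg _.
by exists y, T; split=> //; apply: piso_norm yN yQ sQN nQN.
Qed.

(** If g carries the automorphisms of Q induced by S to automorphisms of P
    induced by S, then all of 'N(Q) lies in the extender of g. *)
Lemma autSX_conj P Q g n : g \in piso Q P -> n \in 'N(Q) ->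
    {in autSX Q, forall a, a ^ g \in autSX P} ->
  exists2 s, s \in 'N(P) &
    {in Q, forall x, g.1 (cconj n x) = cconj s (g.1 x)}
    /\ ell act n ^ g.2 = ell act s.
Proof.
move=> gi nQ gA; have aA : conj_pair Q n \in autSX Q.
  by rewrite autSXE imset_f.
have /mem_autSX[_ [s sP [sE s2]]] := gA _ aA.
exists s => //; split=> [x Qx|]; last by rewrite -s2.
by rewrite -sE ?(piso_mem _ gi) // permJ conj_pairE.
Qed.

(** Let A be the group of automorphisms of P induced by S.  If A were not a
    Sylow subgroup, then, as p-groups grow in normalizers, a p-element x
    outside A would normalize A.  Such an x extends to an automorphism y1
    of 'N(P), and a power y of y1 is a p-element that still extends x.  By
    induction a fully normalized conjugate N0 of 'N(P) is fully automized, so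
    an isomorphism g from 'N(P) to N0 can be chosen such that g carries y to
    conjugation by some s in S.  This s normalizes the image P' of P, whose
    normalizer contains N0 and is no larger, P being fully normalized.
    Therefore s is in N0 and y is conjugation by the preimage of s, which
    puts x in A. *)
Lemma fully_normalized_automized P :
    p.-group [set: S] -> fully_automized p FX [set: S]%G ->
    (forall Q, fully_normalized FX Q -> receiving FX Q) ->
  fully_normalized FX P -> p.-Sylow(autX P) (autSX P).
Proof.
move=> pS autS rec; have [n] := ubnP (#|S| - #|P|).
elim: n P => // n IH P ltPn nP.
have [defP | ltPS] := eqVproper (subsetT P).
  by have -> : P = [set: S]%G by apply: group_inj.
have ltPK : P \proper 'N(P).
  by have := nilpotent_proper_norm (pgroup_nil pS) ltPS; rewrite setTI.
have pA := pgroup_autSX P pS.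
have [T sylT sAT] := Sylow_superset (sub_autSX_autX P) pA.
have [sTG pT _] := and3P sylT.
have [defT | ltAT] := eqVproper sAT; first by rewrite defT.
have := nilpotent_proper_norm (pgroup_nil pT) ltAT.
case/properP=> _ [x /setIP[Tx nAx] nA'x]; case/negP: nA'x.
have px := mem_p_elt pT Tx; have /(subsetP sTG) Gx := Tx.
have := Gx; rewrite mem_autX => /andP[xP xi].
have sPK : P \subset 'N(P) := normG P.
have [|y0 [T0 [y0K nT0 _ y0E y02]]] :=
  receiving_extend (rec P nP) xi sPK (subxx _).
  by move=> k Kk; apply: (autSX_conj xi Kk) => a aA; rewrite memJ_norm.
have y0KK : y0 \in piso 'N(P)%G 'N(P)%G.
  suffices defT0 : T0 = 'N(P)%G by rewrite -[X in piso _ X]defT0.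
  by apply/group_inj/eqP; rewrite eqEcard nT0 (piso_card y0K) /=.
have [y1 y1G [y1E y12]] := piso_autX y0KK.
have {y1E y12}y1x : {in P, y1.1 =1 x.1} /\ y1.2 = x.2.
  by rewrite y12 y02; split=> // z Pz; rewrite y1E ?y0E ?(subsetP sPK).
have [k [xk pyk]] := p_elt_power y1 px; pose y := y1 ^+ k.
have yG : y \in autX 'N(P) by apply: groupX.
have [yE y2] : {in P, y.1 =1 x.1} /\ y.2 = x.2.
  have pX j : {in P, (y1 ^+ j).1 =1 (x ^+ j).1} /\ (y1 ^+ j).2 = (x ^+ j).2.
    elim: j => // j [E1 E2]; split=> [z Pz|].
      rewrite !expgS !permM (proj1 y1x) // E1 //.
      by rewrite (piso_mem _ xi).
    by rewrite !expgS /= E2 (proj2 y1x).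
  by have := pX k; rewrite xk.
have [N0 KN0 nN0] := fully_normalized_conj 'N(P).
have /fconjP[g0 g0i] := KN0.
have sylN0 : p.-Sylow(autX N0) (autSX N0).
  apply: IH nN0; rewrite -(piso_card g0i); move: ltPn; rewrite ltnS.
  apply: leq_trans; have ltK := proper_card ltPK.
  exact: ltn_sub2l (leq_trans ltK (max_card _)) ltK.
have ygG : <[y ^ g0]> \subset autX N0.
  by rewrite cycle_subG -(autXJ g0i) memJ_conjg.
have [|c cG] := Sylow_Jsub sylN0 ygG.
  by rewrite [p.-group _](p_eltJ p y g0).
rewrite -cycleJ cycle_subG -conjgM.
have : c \in piso N0 N0 by move: cG; rewrite mem_autX => /andP[].
move/(pisoM g0i); move: (g0 * c) => g gi /mem_autSX[_ [s _ [sE s2]]].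
have [P' sP'N0 gP] := pisoS gi sPK.
have nP'N0 : N0 \subset 'N(P') := piso_norm gi gP sPK (subxx _).
have defN0 : N0 = 'N(P') :> {set S}.
  apply/eqP; rewrite eqEcard nP'N0 -(piso_card gi).
  exact/nP/fconj_piso/gP.
have gyE : {in P, forall z, cconj s (g.1 z) = g.1 (x.1 z)}.
  move=> z Pz; rewrite -sE ?permJ ?yE //.
  by rewrite (subsetP sP'N0) // (piso_mem _ gP).
have : s \in N0.
  rewrite defN0; apply: norm_cconj; have [_ <- _] := pisoP gP.
  by move=> _ /imsetP[z Pz ->]; rewrite gyE // imset_f ?(piso_mem _ xi).
have [_ defN gX] := pisoP gi; rewrite -defN => /imsetP[m Km defs].
apply/mem_autSX; split=> //; exists m => //; split=> [z Pz|].
  apply: (@perm_inj _ g.1).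
  by rewrite -gyE // (pisoJ gi Km) ?(subsetP sPK) // defs.
by rewrite -y2; apply: (@conjg_inj _ g.2); rewrite gX // -defs -s2.
Qed.

(** * Subgroups dominated by a fully normalized conjugate *)

(** All comparisons of a subgroup Q with a fully normalized conjugate P go
    through such a y.  The image T of the normalizer of Q is only a subgroup
    of that of P, because the latter may be larger. *)
Definition dominates y Q P :=
  y \in piso Q P /\ exists2 T : {group S}, y \in piso 'N(Q) T & T \subset 'N(P).

(** The automorphisms of Q induced by S form a p-group, so that by Sylow some
    isomorphism to P carries them into those of P induced by S; the extender
    of this isomorphism is the whole of 'N(Q). *)
Lemma receiving_dominates P Q : p.-group [set: S] ->
    p.-Sylow(autX P) (autSX P) -> receiving FX P -> fconj FX Q P ->
  exists y, dominates y Q P.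
Proof.
move=> pS sylP rP /fconjP[g0 g0i].
have sAG : autSX Q :^ g0 \subset autX P.
  by rewrite -(autXJ g0i) conjSg sub_autSX_autX.
have [|c cG] := Sylow_Jsub (Q := (autSX Q :^ g0)%G) sylP sAG.
  by rewrite pgroupJ pgroup_autSX.
rewrite -conjsgM.
have : c \in piso P P by move: cG; rewrite mem_autX => /andP[].
move/(pisoM g0i); move: (g0 * c) => g gi /subsetP gA.
have [|y [T [yN nT yQ _ _]]] := receiving_extend rP gi (normG Q) (subxx _).
  by move=> n nQ; apply: (autSX_conj gi nQ) => a aA; rewrite gA ?memJ_conjg.
by exists y; split=> //; exists T.
Qed.

Lemma dominates_norm y Q P n : dominates y Q P -> n \in 'N(Q) ->
  y.1 n \in 'N(P).
Proof.
by case=> _ [T yN sTN] nQ; rewrite (subsetP sTN) // (piso_mem _ yN).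
Qed.

Lemma dominatesJ y Q P n : dominates y Q P -> n \in 'N(Q) ->
  {in Q, forall x, y.1 (cconj n x) = cconj (y.1 n) (y.1 x)}.
Proof.
case=> _ [T yN _] nQ x Qx; apply: (pisoJ yN nQ).
exact: (subsetP (normG Q)).
Qed.

Lemma dominates_ell y Q P n : dominates y Q P -> n \in 'N(Q) ->
  ell act (y.1 n) = ell act n ^ y.2.
Proof. by case=> _ [T /pisoP[_ _ yX] _] nQ; rewrite yX. Qed.

Lemma conj_pairJ y Q P n : dominates y Q P -> n \in 'N(Q) ->
  conj_pair Q n ^ y = conj_pair P (y.1 n).
Proof.
move=> yQP nQ; have [yi _] := yQP; apply: conj_pair_eq.
- exact: dominates_norm yQP nQ.
- suffices : conj_pair Q n ^ y \in autX P by rewrite mem_autX => /andP[].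
  rewrite -(autXJ yi) memJ_conjg (subsetP (sub_autSX_autX Q)) //.
  by rewrite autSXE imset_f.
- have [_ defP _] := pisoP yi; move=> x; rewrite -{1}defP => /imsetP[z Qz ->].
  by rewrite permJ conj_pairE // (dominatesJ yQP).
by rewrite (dominates_ell yQP).
Qed.

(** Each of the subgroups whose order is maximized over a conjugacy class in
    the definition of saturation (norm_ker, the centralizer and cent_ker) is
    preserved and reflected by dominating isomorphisms; this is the only
    property on which the comparison of these orders depends. *)
Definition natural (F : {group S} -> {set S}) :=
  (forall P, F P \subset 'N(P)) /\
  (forall y Q P, dominates y Q P ->
     {in 'N(Q), forall n, (y.1 n \in F P) = (n \in F Q)}).

Definition fully (F : {group S} -> {set S}) P :=
  forall Q, fconj FX P Q -> #|F Q| <= #|F P|.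

Lemma natural_cent : natural (fun P => 'C(P)).
Proof.
split=> [P | y Q P yQP n nQ]; first exact: cent_sub.
have [/pisoP[_ defP _] _] := yQP.
apply/cent_cconj/cent_cconj => nC x.
  move=> Qx; apply: (@perm_inj _ y.1).
  by rewrite (dominatesJ yQP) ?nC // -defP imset_f.
by rewrite -{1}defP => /imsetP[z Qz ->]; rewrite -(dominatesJ yQP) ?nC.
Qed.

Lemma dominates_act_ker y Q P n : dominates y Q P -> n \in 'N(Q) ->
  (y.1 n \in act_ker act) = (n \in act_ker act).
Proof. by move=> yQP nQ; rewrite !inE (dominates_ell yQP nQ) conjg_eq1. Qed.

Lemma natural_norm_ker : natural (norm_ker act).
Proof.
split=> [P | y Q P yQP n nQ]; first exact: subsetIl.
by rewrite !in_setI (dominates_act_ker yQP) // (dominates_norm yQP) // nQ.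
Qed.

Lemma natural_cent_ker : natural (cent_ker act).
Proof.
split=> [P | y Q P yQP n nQ].
  exact: subset_trans (subsetIl _ _) (cent_sub P).
by rewrite !in_setI (dominates_act_ker yQP) // (proj2 natural_cent y Q P yQP).
Qed.

Lemma natural_sub F y Q P : natural F -> dominates y Q P ->
  y.1 @: F Q \subset F P.
Proof.
case=> sFN Fy yQP; apply/subsetP=> _ /imsetP[n Fn ->].
by rewrite (Fy _ _ _ yQP) // (subsetP (sFN Q)).
Qed.

Lemma natural_leq F y Q P : natural F -> dominates y Q P -> #|F Q| <= #|F P|.
Proof.
move=> nF yQP; rewrite -(card_imset (F Q) (@perm_inj _ y.1)).
exact/subset_leq_card/natural_sub.
Qed.

(** A dominating isomorphism injects F Q into F P, so that maximality of the
    order of F Q forces it to be surjective. *)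
Lemma fully_onto F y Q P : natural F -> dominates y Q P -> fully F Q ->
  y.1 @: F Q = F P.
Proof.
move=> nF yQP FQ; apply/eqP; rewrite eqEcard natural_sub //=.
by rewrite card_imset; [apply/FQ/fconj_piso/(proj1 yQP) | apply: perm_inj].
Qed.

(** * Projections and kernels

    The automorphism groups of the fusion system and the groups of
    permutations of X are the images of aut_pairs under the two projections,
    and their subscript 0 versions come from the kernels of the projections. *)
Lemma fst_aut_pairs P (A : {set mor S X}) :
  fst @* aut_pairs P A = aut_perms P [set m.1 | m in A].
Proof.
apply/setP=> b; apply/morphimP/idP=> [[a _ + ->]|].
  rewrite [a \in _]inE => /andP[aP aA]; rewrite inE aP.
  by apply/imsetP; exists (restr P a.1, a.2).
rewrite inE => /andP[bP /imsetP[m mA bm]].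
exists (b, m.2) => //.
by rewrite [_ \in aut_pairs P A]inE /= bP bm -surjective_pairing.
Qed.

Lemma fst_aut_pairs_ker P (A : {set mor S X}) :
  fst @* (aut_pairs P A :&: 'ker (@snd {perm S} {perm X}))
  = aut_perms P [set f : {ffun S -> S} | (f, 1) \in A].
Proof.
apply/setP=> b; apply/morphimP/idP=> [[[a1 a2] _ + ->]|].
  by rewrite !inE /= => /andP[/andP[-> aA] /eqP <-].
rewrite !inE => /andP[bP bA]; exists (b, 1) => //.
by rewrite !inE /= bP bA eqxx.
Qed.

Lemma snd_aut_pairs P (A : {set mor S X}) : A \subset U_hom act P P ->
  snd @* aut_pairs P A = [set m.2 | m in A].
Proof.
move=> sAU; apply/setP=> b; apply/morphimP/imsetP=> [[a _ + ->]|[m mA ->]].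
  by rewrite inE => /andP[_ aA]; exists (restr P a.1, a.2).
have := subsetP sAU m mA; rewrite inE => /andP[/inj_homs_Aut[a aP am] _].
exists (a, m.2) => //.
by rewrite [_ \in aut_pairs P A]inE /= aP am -surjective_pairing.
Qed.

Lemma snd_aut_pairs_ker P (A : {set mor S X}) :
  snd @* (aut_pairs P A :&: 'ker (@fst {perm S} {perm X}))
  = [set sg | (hid P, sg) \in A].
Proof.
apply/setP=> b; apply/morphimP/idP=> [[[a1 a2] _ + ->]|].
  by rewrite !inE /= => /andP[/andP[_ aA] /eqP a1E]; rewrite -restr_Aut1 -a1E.
rewrite inE => bA; exists (1, b) => //.
apply/setIP; split; first by rewrite inE /= group1 restr_Aut1.
by rewrite !inE /=.
Qed.

Lemma AutS_fst P : AutS P = [set m.1 | m in AutSX act P].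
Proof. by rewrite /AutSX -imset_comp. Qed.

Lemma SigmaS_snd P : SigmaS act P = [set m.2 | m in AutSX act P].
Proof. by rewrite /AutSX -imset_comp. Qed.

Lemma fusS0_ker P :
  fusS0 act P = [set f : {ffun S -> S} | (f, 1) \in AutSX act P].
Proof.
apply/setP=> f; rewrite inE; apply/imsetP/imsetP=> -[s].
  case/setIP=> sP; rewrite inE => /eqP sX ->.
  by exists s; rewrite // /inner sX.
by move=> sP [-> sX]; exists s => //; rewrite in_setI sP inE -sX eqxx.
Qed.

Lemma SigmaS0_ker P :
  SigmaS0 act P = [set sg | (hid P, sg) \in AutSX act P].
Proof.
apply/setP=> sg; rewrite inE; apply/imsetP/imsetP=> -[s sP].
  move=> ->; exists s; first exact: (subsetP (cent_sub P)).
  congr (_, _); apply/ffunP=> x; rewrite !ffunE; case: ifP => // Px.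
  by rewrite (cent_cconj _ _ sP).
case=> /ffunP sE ->; exists s => //; apply/cent_cconj=> x Px.
by have := sE x; rewrite !ffunE Px.
Qed.

(** * From the receiving property to saturation *)

Section Saturation.

Hypothesis pS : p.-group [set: S].
Hypothesis autS : fully_automized p FX [set: S]%G.
Hypothesis rec : forall P, fully_normalized FX P -> receiving FX P.

Lemma fully_normalized_dominates P Q : fully_normalized FX P -> fconj FX Q P ->
  exists y, dominates y Q P.
Proof.
move=> nP QP; have sylP := fully_normalized_automized pS autS rec nP.
exact: receiving_dominates pS sylP (rec nP) QP.
Qed.

Lemma dominated Q :
  exists y, exists2 P, fully_normalized FX P & dominates y Q P.
Proof.
have [P QP nP] := fully_normalized_conj Q.
by have [y yQP] := fully_normalized_dominates nP QP; exists y, P.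
Qed.

Lemma fully_normalized_fully F P :
  natural F -> fully_normalized FX P -> fully F P.
Proof.
move=> nF nP Q /fconj_sym QP.
by have [y yQP] := fully_normalized_dominates nP QP; apply: natural_leq yQP.
Qed.

(** Surjectivity of y from F Q to F P passes to the smaller subgroups F' Q and
    F' P, because naturality detects F' on both sides.  So F' Q has the order
    of F' P, which is the largest in the class. *)
Lemma fully_sub F F' Q : natural F -> natural F' ->
  (forall P, F' P \subset F P) -> fully F Q -> fully F' Q.
Proof.
move=> nF nF' sF'F FQ R QR; have [y [P nP yQP]] := dominated Q.
have PR : fconj FX P R := fconj_trans (fconj_sym (fconj_piso (proj1 yQP))) QR.
apply: leq_trans (fully_normalized_fully nF' nP PR) _.
rewrite -(card_imset (F' Q) (@perm_inj _ y.1)).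
apply/subset_leq_card/subsetP=> t F't.
have := subsetP (sF'F P) t F't; rewrite -(fully_onto nF yQP FQ).
case/imsetP=> n Fn deft; apply/imsetP; exists n => //.
by rewrite -(proj2 nF' _ _ _ yQP) -?deft // (subsetP (proj1 nF Q)).
Qed.

Lemma autSX_ker_snd P :
  autSX P :&: 'ker (@snd {perm S} {perm X}) = conj_pair P @: norm_ker act P.
Proof.
rewrite autSXE; apply/setP=> a; apply/setIP/imsetP=> [[/imsetP[s sP ->]]|[s]].
  rewrite !inE => /= sX; exists s => //.
  by rewrite in_setI sP inE.
case/setIP=> sP; rewrite inE => sX ->; split; first exact: imset_f.
by rewrite !inE.
Qed.

Lemma autSX_ker_fst P :
  autSX P :&: 'ker (@fst {perm S} {perm X}) = conj_pair P @: 'C(P).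
Proof.
rewrite autSXE; apply/setP=> a.
apply/setIP/imsetP=> [[/imsetP[s sP ->]]|[s sC]].
  rewrite !inE => /eqP s1; exists s => //; apply/cent_cconj=> x Px.
  by rewrite -(conj_pairE sP) // s1 perm1.
have sP := subsetP (cent_sub P) s sC; move=> ->; split; first exact: imset_f.
rewrite !inE; apply/eqP/(eq_Aut (Aut_aut _ _) (group1 (Aut_group P))) => x Px.
rewrite -[aut _ _]/((conj_pair P s).1) conj_pairE // perm1.
by apply/cent_cconj: x Px.
Qed.

(** For a fully normalized P this holds because a Sylow subgroup meets a
    normal subgroup in a Sylow subgroup.  The maximality of F Q makes a
    dominating isomorphism transport the statement from P back to Q. *)
Lemma fully_Sylow F (K : {group perms}) Q :
    natural F -> K <| [set: perms] ->
    (forall P, autSX P :&: K = conj_pair P @: F P) -> fully F Q ->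
  p.-Sylow(autX Q :&: K) (autSX Q :&: K).
Proof.
move=> nF nK AK FQ; have [y [P nP yQP]] := dominated Q; have [yi _] := yQP.
have Ky : K :^ y = K by apply: (normsP (normal_norm nK)); rewrite inE.
have AKy : (autSX Q :&: K) :^ y = autSX P :&: K.
  rewrite !AK -(fully_onto nF yQP FQ) -imset_comp /conjugate -imset_comp.
  apply: eq_in_imset => n Fn; apply: (conj_pairJ yQP).
  exact: (subsetP (proj1 nF Q)).
rewrite -(pHallJ2 p _ _ y) AKy conjIg (autXJ yi) Ky.
have nKG : autX P :&: K <| autX P by rewrite (normalGI (subsetT _)).
have := Hall_setI_normal nKG (fully_normalized_automized pS autS rec nP).
by rewrite setIA (setIidPl (sub_autSX_autX P)).
Qed.

(** Let y dominate Q by a fully normalized R.  As R is receiving, the composite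
    of m and y extends to some z on the extender E of m, and z followed by the
    inverse of y is the desired extension, provided that z maps E into the
    image of 'N(Q) under y.  For n in E, let s in 'N(Q) induce the transport of
    n by m: then z.1 n and y.1 s act alike on R and on X, so they differ by an
    element of cent_ker R.  Since Q is fully X-centralized, such an element
    comes from cent_ker Q. *)
Lemma fully_Xcentralized_extends P Q m :
  fully_Xcentralized FX Q -> m \in isos FX P Q -> extends FX P Q m.
Proof.
move=> cQ mi; have [y [R nR yQR]] := dominated Q; have [yi [T0 y0 sT0]] := yQR.
have [g gi gm] := piso_lift mi; have hi := pisoM gi yi.
pose E := extender act P Q m.
have mF : m \in FX P Q by move: mi; rewrite isosE => /andP[].
have [_ mI mP] := isos_imset (@fas_sub _ _ _ FX) mi.
have gX n : n \in E -> n \in 'N(P) /\ exists2 s, s \in 'N(Q) &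
    {in P, forall x, g.1 (cconj n x) = cconj s (g.1 x)}
    /\ ell act n ^ g.2 = ell act s.
  rewrite [n \in E](_ : _ = (n \in extender_set act P Q m)); last first.
    by rewrite -(extenderE mi).
  case/extender_setP=> //; first exact: (FX_one mF).
  move=> nP [s sQ [E1 E2]]; split=> //; exists s => //.
  move: E1 E2; rewrite -gm /= => E1 E2; split=> [x Px|].
    by have := E1 x Px; rewrite !ffunE cconj_norm // Px.
  by rewrite conjgE mulgA.
have nPE : E \subset 'N(P) by apply/subsetP=> n /gX[].
have sPE : P \subset E.
  rewrite /E (extenderE mi); apply/subsetP=> n Pn; have [_ _ gE] := pisoP gi.
  apply/extender_setP=> //; first exact: (FX_one mF).
  split; first exact: (subsetP (normG P)).
  exists (g.1 n); first by rewrite (subsetP (normG Q)) // (piso_mem _ gi).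
  rewrite -gm /=; split=> [x Px|]; last by rewrite -gE // conjgE mulgA.
  by rewrite !ffunE cconj_norm ?(subsetP (normG P)) // Px (pisoJ gi).
have [|z [T [zE sTR _ zh z2]]] := receiving_extend (rec nR) hi sPE nPE.
  move=> n /gX[nP [s sQ [E1 E2]]]; exists (y.1 s).
    exact: dominates_norm yQR sQ.
  split=> [x Px|]; last by rewrite (dominates_ell yQR) // -E2 /= conjgM.
  by rewrite !permM E1 // (dominatesJ yQR) ?(piso_mem _ gi).
have sTT0 : T \subset T0.
  have [_ defT zX] := pisoP zE; have [_ defT0 _] := pisoP y0.
  apply/subsetP=> t; rewrite -defT => /imsetP[n En ->].
  have [nP [s sQ [E1 E2]]] := gX n En.
  have ysR := dominates_norm yQR sQ.
  have : z.1 n * (y.1 s)^-1 \in cent_ker act R.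
    rewrite in_setI; apply/andP; split; last first.
      rewrite inE ellM -zX // z2 /= conjgM E2 -(dominates_ell yQR sQ).
      by rewrite -ellM mulgV ell1.
    apply: mulV_cent => // r.
    have [_ defR _] := pisoP hi; rewrite -{1}defR => /imsetP[x Px ->].
    rewrite -{1}zh // -(pisoJ zE En) ?(subsetP sPE) // zh ?cconj_norm // permM.
    by rewrite E1 // (dominatesJ yQR) ?(piso_mem _ gi) // permM.
  rewrite -(fully_onto natural_cent_ker yQR cQ) => /imsetP[c cC defc].
  have cN := subsetP (proj1 natural_cent_ker Q) c cC.
  have [yM _ _] := pisoP y0; rewrite -defT0.
  apply/imsetP; exists (c * s); first exact: groupM.
  by rewrite yM //= -defc mulgKV.
have [T' sT'Q yV] := pisoS (pisoV y0) sTT0.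
have wi := pisoM zE yV; exists (restr E (z * y^-1).1).
  move: wi; rewrite pisoE => /andP[wF _].
  suffices <- : (z * y^-1).2 = m.2 by apply: FX_codom wF (subsetT _).
  by rewrite /= z2 -gm /= mulgK.
rewrite -gm; apply/ffunP=> x; rewrite !ffunE; case: ifP => // Px.
by rewrite (subsetP sPE) // permM zh // permM permK.
Qed.

Lemma saturated_of_receiving : saturated p FX.
Proof.
split=> [P nP|P nP|P nP|P nP|P nP|P nP|P Q m].
- split; first exact: (fully_normalized_fully natural_norm_ker nP).
  exact: (fully_normalized_fully natural_cent nP).
- apply: (fully_sub natural_norm_ker natural_cent_ker _ nP) => Q.
  exact/setSI/cent_sub.
- apply: (fully_sub natural_cent natural_cent_ker _ nP) => Q.
  exact: subsetIl.
- have sylP := fully_normalized_automized pS autS rec nP; split=> //.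
    have := morphim_pHall (@fst_morphism _ _) (subsetT _) sylP.
    by rewrite /= !fst_aut_pairs AutS_fst.
  have := morphim_pHall (@snd_morphism _ _) (subsetT _) sylP.
  rewrite /= !snd_aut_pairs ?fas_sub ?SigmaS_snd //.
  exact: subset_trans (sub_AutSX P) (fas_sub FX P P).
- have := fully_Sylow natural_norm_ker (ker_normal _) autSX_ker_snd nP.
  move/(morphim_pHall (@fst_morphism _ _) (subsetT _)).
  by rewrite /= !fst_aut_pairs_ker fusS0_ker.
- have := fully_Sylow natural_cent (ker_normal _) autSX_ker_fst nP.
  move/(morphim_pHall (@snd_morphism _ _) (subsetT _)).
  by rewrite /= !snd_aut_pairs_ker SigmaS0_ker.
exact: fully_Xcentralized_extends.
Qed.

End Saturation.

(** S is trivially fully normalized, and the extension axiom applies to the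
    isomorphisms onto any fully normalized subgroup because the first axiom
    makes it fully X-centralized. *)
Lemma receiving_of_saturated : saturated p FX ->
  fully_automized p FX [set: S]%G
  /\ (forall P, fully_normalized FX P -> receiving FX P).
Proof.
move=> sat; split=> [|P nP Q m].
  have nS : fully_normalized FX [set: S]%G.
    move=> Q _; apply: subset_leq_card.
    apply: subset_trans (subsetT _) (normG _).
  by have [_ ] := sat_sylow sat nS.
apply: (sat_extension sat); have [XnP _] := sat_normalized sat nP.
exact: (sat_Xnormalized sat XnP).
Qed.

End FusionActionSystem.

Theorem theorem2p5p8 (p : nat) (S : finGroupType) (X : finType)
    (act : left_action S X) (FX : fusion_action_system act) :
  prime p -> p.-group [set: S] ->
  (saturated p FX <->
   fully_automized p FX [set: S]%G
   /\ (forall P : {group S}, fully_normalized FX P -> receiving FX P)).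
Proof.
move=> _ pS; split; first exact: receiving_of_saturated.
by case=> autS rec; apply: saturated_of_receiving.
Qed.
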